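(* Let $X_1,X_2,\ldots$ be independent real random variables with $\mathbb{E}X_j=0$ and $\mathbb{E}X_j^2=\sigma_j^2<\infty$. Put $S_n=X_1+\cdots+X_n$ and $s_n=(\sigma_1^2+\cdots+\sigma_n^2)^{1/2}$. For a function $N\mapsto f_N$ put $$I=\liminf_{N\to\infty}\ \max_{N<s_n^2\le Nf_N}\frac{|S_n|}{s_n},$$ where the maximum is over positive integers $n$ with $N<s_n^2\le Nf_N$. Consider the following conditions. (a) $s_n\to\infty$ as $n\to\infty$. (b) There is a constant $C$ such that $s_{j+1}/s_j\le C$ for all $j$ with $s_j>0$. (c) For every $\lambda>0$ there is a constant $c_\lambda>0$ such that, if $n$ is large enough and $s_m^2>2s_n^2$, then $\mathbb{P}\big(|S_m-S_n|\ge\lambda s_m\big)\ge c_\lambda$. Then: (i) If (a) and (b) hold and $f_N=(\log N)^M$ for some constant $M>0$, then $I<\infty$ almost surely. (ii) If (a), (b) and (c) hold and $f_N=(\log N)^{\xi(N)}$ with $\xi(N)$ tending monotonically to $\infty$ as $N\to\infty$, then $I=\infty$ almost surely.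
   Context: $N$ ranges over the positive integers, and $\log$ is the natural logarithm. Only large $N$ matter for the $\liminf$. In condition (c), ''$n$ large enough'' means $n\ge n_0(\lambda)$ for some $n_0(\lambda)$ that may depend on $\lambda$. *)

(* Defs.v *)
From HB Require Import structures.
From mathcomp Require Import all_boot all_order all_algebra finmap.
From mathcomp Require Import all_classical all_reals all_analysis.

Set Implicit Arguments.
Unset Strict Implicit.
Unset Printing Implicit Defensive.

Import Order.TTheory GRing.Theory Num.Theory.
Import numFieldNormedType.Exports.

Local Open Scope classical_set_scope.
Local Open Scope ring_scope.

(* Sequences are indexed from 0: X i and sigma i stand for X_{i+1} and
   sigma_{i+1}, so that psum X n = X_1 + ... + X_n and
   sdev sigma n = (sigma_1^2 + ... + sigma_n^2)^(1/2); in particular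
   psum X 0 = 0 and sdev sigma 0 = 0. *)

Definition mutually_independent (d : measure_display) (T : measurableType d)
    (R : realType) (P : probability T R) (X : nat -> {RV P >-> R}) : Prop :=
  forall (J : {fset nat}) (A : nat -> set R),
    (forall i, measurable (A i)) ->
    P (\bigcap_(i in [set` J]) (X i @^-1` A i)) =
      (\prod_(i <- J) P (X i @^-1` A i))%E.

Definition psum (T : Type) (R : realType) (X : nat -> T -> R) (n : nat) (w : T)
  : R := \sum_(i < n) X i w.

Definition sdev (R : realType) (sigma : nat -> R) (n : nat) : R :=
  Num.sqrt (\sum_(i < n) sigma i ^+ 2).

(* The index n = 0 never satisfies the constraint. When sdev sigma tends to
   +oo the index set is finite, so the supremum is a maximum as soon as the set
   is nonempty; the supremum of the empty set is -oo. *)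
Definition window_max (T : Type) (R : realType) (X : nat -> T -> R)
    (sigma : nat -> R) (f : nat -> R) (w : T) (N : nat) : \bar R :=
  ereal_sup [set (`|psum X n w| / sdev sigma n)%:E | n in
    [set n | N%:R < sdev sigma n ^+ 2 <= N%:R * f N]].

Definition liminf_max (T : Type) (R : realType) (X : nat -> T -> R)
    (sigma : nat -> R) (f : nat -> R) (w : T) : \bar R :=
  limn_einf (window_max X sigma f w).

(* Main.v *)
Require Import Defs.
From HB Require Import structures.
From mathcomp Require Import all_boot all_order all_algebra finmap.
From mathcomp Require Import all_classical all_reals all_analysis.
From mathcomp Require Import measurable_realfun ring lra zify.

Set Implicit Arguments.
Unset Strict Implicit.
Unset Printing Implicit Defensive.

Import Order.TTheory GRing.Theory Num.Theory.
Import numFieldNormedType.Exports.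

Local Open Scope classical_set_scope.
Local Open Scope ring_scope.

(** Cut the index axis into blocks [b j, b (j+1)) at the end of which the
    standard deviation has been multiplied by a factor between 2 and 2C: this is
    possible because s tends to infinity with bounded ratios. Since log s (b j)
    grows linearly in j, a window N < s_n^2 <= N f_N with f_N = (log N)^M
    contains of the order of M log j consecutive blocks when it starts at block
    j, and more than any multiple of log j when M is replaced by a function
    tending to infinity. The increments of S over distinct blocks are
    independent, so the question becomes how long a run of exceptional blocks
    one sees near block j.

    When f_N = (log N)^xi(N), each block has probability at least c of carrying
    an increment larger than lambda s, and such an increment forces |S_n| to be
    at least (lambda/2) s_n at one of its two ends. The probability that A r
    consecutive blocks starting at a given j < 2^r all fail is at most
    (1-c)^(A r), which beats the number 2^r of starting points once A is
    large. By Borel-Cantelli, almost surely no such run of failures exists for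
    large r, and every late window starting near block j < 2^r contains A r
    blocks ([large_window], [window_max_ge_half]).

    When f_N = (log N)^M, call a block quiet if S moves by less than kappa s
    throughout it. A maximal inequality ([pr_large_excursion]) makes a block
    quiet with probability 1 - O(1/kappa^2); for kappa large compared with A, a
    run of A r quiet blocks has probability at least (3/4)^r, so that among 2^r
    disjoint candidates one run occurs, outside an event of probability at most
    (2/3)^r. Along a run of quiet blocks the oscillations of S add up like a
    geometric series, hence stay bounded by a constant times s; what S had
    accumulated before the run is negligible after its first r blocks, by
    Chebyshev. A window placed inside the run after these r blocks
    ([small_window]) therefore has a bounded maximum ([run_bound]), and this
    happens for arbitrarily large N.

    Independence is given for the individual variables; passing to blocks is a
    pi-lambda argument ([sigmaX_indep]), and the variance of an increment comes
    from E[UV] = E[U] E[V] for independent U, V ([expectation_mul_indep]). *)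

(** * Independence of blocks of coordinates *)

Section Independence.
Context (d : measure_display) (T : measurableType d) (R : realType)
  (P : probability T R).

(** Probabilities as real numbers, so that linear arithmetic applies. *)
Definition pr (A : set T) : R := fine (P A).

Lemma prE (A : set T) : measurable A -> P A = (pr A)%:E.
Proof. by move=> mA; rewrite /pr fineK// fin_num_measure. Qed.

Lemma pr_ge0 (A : set T) : 0 <= pr A.
Proof. by rewrite /pr fine_ge0. Qed.

Lemma pr_le (A B : set T) : measurable A -> measurable B -> A `<=` B ->
  pr A <= pr B.
Proof.
move=> mA mB AB; rewrite -lee_fin -!prE//.
by apply: le_measure => //; rewrite inE.
Qed.

Lemma pr_le1 (A : set T) : measurable A -> pr A <= 1.
Proof. by move=> mA; rewrite -lee_fin -prE// probability_le1. Qed.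

Lemma prC (A : set T) : measurable A -> pr (~` A) = 1 - pr A.
Proof.
move=> mA; apply: EFin_inj; rewrite -prE; last exact: measurableC.
by rewrite probability_setC// prE// EFinB.
Qed.

Lemma prU (A B : set T) : measurable A -> measurable B -> A `&` B = set0 ->
  pr (A `|` B) = pr A + pr B.
Proof.
move=> mA mB AB; apply: EFin_inj; rewrite -prE; last exact: measurableU.
by rewrite measureU// EFinD -!prE.
Qed.

Lemma prT : pr setT = 1.
Proof. by rewrite /pr probability_setT. Qed.

Lemma prU_le (A B : set T) : measurable A -> measurable B ->
  pr (A `|` B) <= pr A + pr B.
Proof.
move=> mA mB; rewrite (_ : A `|` B = A `|` (B `\` A)); last first.
  by rewrite setDE setUIr setUCr setIT.
have mBA : measurable (B `\` A) by exact: measurableD.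
rewrite prU//; first by rewrite lerD2l; exact: pr_le.
by rewrite setDE setICA setICr setI0.
Qed.

Lemma pr_bigcup_le (A : nat -> set T) n (c : R) :
  (forall i, (i < n)%N -> measurable (A i)) ->
  (forall i, (i < n)%N -> pr (A i) <= c) ->
  pr (\big[setU/set0]_(i < n) A i) <= n%:R * c.
Proof.
move=> mA Ac; rewrite -lee_fin -prE; last first.
  by apply: bigsetU_measurable => i _; exact: mA.
apply: (le_trans (Boole_inequality P mA)).
apply: (@le_trans _ _ (\sum_(i < n) (pr (A i))%:E)%E).
  by apply: lee_sum => i _; rewrite -prE//; exact: mA.
rewrite sumEFin lee_fin mulr_natl -[X in _ *+ X]card_ord -sumr_const.
by apply: ler_sum => i _; exact: Ac.
Qed.

(** Two finite measures that agree on a pi-system agree on the sigma-algebra it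
    generates; the measures here are the trace of [P] on [B] and [P B * P]. *)
Lemma indep_generated (G : set (set T)) (B : set T) :
  G setT -> setI_closed G -> G `<=` measurable -> measurable B ->
  (forall A, G A -> pr (A `&` B) = pr A * pr B) ->
  forall A, <<s G >> A -> pr (A `&` B) = pr A * pr B.
Proof.
move=> GT GI Gm mB H A sA.
have mA : measurable A.
  by move: A sA; apply: smallest_sub => //; exact: sigma_algebra_measurable.
pose r := NngNum (pr_ge0 B).
suff E : mrestr P mB A = mscale r P A.
  apply: EFin_inj; rewrite -prE; last exact: measurableI.
  by move: E; rewrite /mrestr /mscale/= => ->; rewrite mulrC EFinM -(prE mA).
apply: (@g_sigma_algebra_measure_unique _ R T G Gm (fun=> setT) (fun=> GT) _
  (mrestr P mB) (mscale r P) GI _ _ A sA).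
- by rewrite bigcup_const//; exists 0%N.
- move=> C GC; rewrite /= /mrestr /mscale prE; last first.
    by apply: measurableI => //; exact: Gm.
  by rewrite H// mulrC EFinM -(prE (Gm _ GC)).
- by move=> _; rewrite /= /mrestr setTI prE// ltry.
Qed.

Variable X : nat -> {RV P >-> R}.

Definition coord_events (a c : nat) : set (set T) :=
  [set B | exists i A, [/\ (a <= i < c)%N, measurable A & B = X i @^-1` A]].

Definition sigmaX (a c : nat) : set (set T) := <<s coord_events a c >>.

Lemma measurable_coord i (A : set R) : measurable A -> measurable (X i @^-1` A).
Proof. by move=> mA; rewrite -[_ @^-1` _]setTI; exact: measurable_funP. Qed.

Lemma sigmaX_measurable a c : sigmaX a c `<=` measurable.
Proof.
apply: smallest_sub; first exact: sigma_algebra_measurable.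
by move=> _ [i [A [_ mA ->]]]; exact: measurable_coord.
Qed.

Lemma sigmaX_sub a c a' c' : (a' <= a)%N -> (c <= c')%N ->
  sigmaX a c `<=` sigmaX a' c'.
Proof.
move=> aa cc; apply: sub_sigma_algebra2 => _ [i [A [/andP[ai ic] mA ->]]].
exists i, A; split => //.
by rewrite (leq_trans aa ai) (leq_trans ic cc).
Qed.

(** The same carrier with [sigmaX a c] as its measurable sets, so that the
    stability properties of measurable sets and functions apply to it. *)
Definition blockT a c : Type := g_sigma_algebraType (coord_events a c).
HB.instance Definition _ a c := Measurable.on (blockT a c).

Lemma sigmaXE a c (A : set T) :
  sigmaX a c A = measurable (A : set (blockT a c)).
Proof. by []. Qed.

Lemma measurable_coord_block a c i : (a <= i < c)%N ->
  measurable_fun setT (X i : blockT a c -> R).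
Proof.
move=> aic _ B mB; rewrite setTI; apply: sub_sigma_algebra.
by exists i, B.
Qed.

(** A pi-system generating [sigmaX a c]. The factors are indexed by a set [J]
    that may exceed the range [a, c), with trivial factors outside the range:
    cylinders over disjoint ranges are then products over the same index set and
    can be multiplied factor by factor. *)
Definition cylinder (J : {fset nat}) (a c : nat) : set (set T) :=
  [set B | exists A : nat -> set R, [/\ forall i, measurable (A i),
    forall i, ~~ (a <= i < c)%N -> A i = setT &
    B = \bigcap_(i in [set` J]) (X i @^-1` A i)]].

Lemma cylinder_setT J a c : cylinder J a c setT.
Proof.
exists (fun=> setT); split => //; apply/esym/seteqP; split => // w _ i _ //.
Qed.

Lemma cylinder_setI J a c : setI_closed (cylinder J a c).
Proof.
move=> _ _ [A [mA AT ->]] [B [mB BT ->]].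
exists (fun i => A i `&` B i); split.
- by move=> i; exact: measurableI.
- by move=> i ai; rewrite AT// BT// setTI.
- by rewrite -bigcapI; apply: eq_bigcapr => i _; rewrite preimage_setI.
Qed.

Lemma cylinder_measurable J a c : cylinder J a c `<=` measurable.
Proof.
move=> _ [A [mA _ ->]]; apply: fin_bigcap_measurable => // i _.
exact: measurable_coord.
Qed.

Lemma coord_cylinder (J : {fset nat}) a c :
  (forall i, (a <= i < c)%N -> i \in J) ->
  coord_events a c `<=` cylinder J a c.
Proof.
move=> J_ac _ [i [A [aic mA ->]]].
exists (fun j => if j == i then A else setT); split.
- by move=> j; case: eqP.
- by move=> j aj; case: eqP => // ji; rewrite ji aic in aj.
- apply/seteqP; split => [w Aw j _/=|w /(_ i (J_ac i aic))/=].
    by case: eqP => // ->.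
  by rewrite eqxx.
Qed.

Hypothesis indX : mutually_independent X.

(** At every index one of the two factors is trivial. *)
Lemma cylinder_indep J a c e A B : (a <= c)%N -> cylinder J a c A ->
  cylinder J c e B -> pr (A `&` B) = pr A * pr B.
Proof.
move=> ac cA cB; apply: EFin_inj; rewrite EFinM -!prE//.
- case: cA => A' [mA AT ->]; case: cB => B' [mB BT ->].
  rewrite -bigcapI (eq_bigcapr (G := fun i => X i @^-1` (A' i `&` B' i))) //.
  rewrite !indX//; last by move=> i; exact: measurableI.
  rewrite -big_split/=; apply: eq_bigr => i _.
  have [ic|ci] := ltnP i c.
    rewrite (BT i); last by rewrite leqNgt ic.
    by rewrite setIT preimage_setT probability_setT mule1.
  rewrite (AT i); last by rewrite [in X in _ && X]ltnNge ci andbF.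
  by rewrite setTI preimage_setT probability_setT mul1e.
- exact: cylinder_measurable cB.
- exact: cylinder_measurable cA.
- by apply: measurableI; [exact: cylinder_measurable cA|
    exact: cylinder_measurable cB].
Qed.

(** The pi-lambda argument is applied twice, once to each of the two events,
    with the other one held fixed. *)
Lemma sigmaX_indep a c e A B : (a <= c)%N -> sigmaX a c A -> sigmaX c e B ->
  pr (A `&` B) = pr A * pr B.
Proof.
move=> ac sA sB; pose J := [fset i in iota 0 (c + e)]%fset.
have JP x y i : (y <= c + e)%N -> (x <= i < y)%N -> i \in J.
  move=> ye /andP[_ iy]; rewrite !inE/= mem_iota add0n.
  exact: leq_trans iy ye.
have gen x y : (y <= c + e)%N -> sigmaX x y `<=` <<s cylinder J x y >>.
  move=> yce; apply: sub_sigma_algebra2; apply: coord_cylinder => i.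
  exact: JP.
have mB := sigmaX_measurable sB.
apply: (@indep_generated (cylinder J a c)) => //.
- exact: cylinder_setT.
- exact: cylinder_setI.
- exact: cylinder_measurable.
- move=> C cC; rewrite setIC mulrC.
  apply: (@indep_generated (cylinder J c e)).
  + exact: cylinder_setT.
  + exact: cylinder_setI.
  + exact: cylinder_measurable.
  + exact: cylinder_measurable cC.
  + by move=> D cD; rewrite setIC mulrC; exact: cylinder_indep cC cD.
  + by apply: gen sB; rewrite leq_addl.
- by apply: gen sA; rewrite leq_addr.
Qed.

Lemma sigmaX_bigcap (b : nat -> nat) (E : nat -> set T) m n :
  {homo b : i j / (i <= j)%N} ->
  (forall j, (m <= j < m + n)%N -> sigmaX (b j) (b j.+1) (E j)) ->
  sigmaX (b m) (b (m + n)%N) (\big[setI/setT]_(m <= j < m + n) E j).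
Proof.
move=> bm sE; rewrite sigmaXE big_nat_cond.
apply: bigsetI_measurable => j /andP[/andP[mj jn] _].
rewrite -sigmaXE; apply: (@sigmaX_sub (b j) (b j.+1)); try exact: bm.
by apply: sE; rewrite mj.
Qed.

(** Peel off the last block: the others lie in the sigma-algebra of the
    coordinates before it. *)
Lemma pr_block_bigcap (b : nat -> nat) (E : nat -> set T) m n :
  {homo b : i j / (i <= j)%N} ->
  (forall j, (m <= j < m + n)%N -> sigmaX (b j) (b j.+1) (E j)) ->
  pr (\big[setI/setT]_(m <= j < m + n) E j) = \prod_(m <= j < m + n) pr (E j).
Proof.
move=> bm; elim: n => [|n IH] sE.
  by rewrite addn0 !big_geq// prT.
rewrite addnS !big_nat_recr ?leq_addr//=.
rewrite (@sigmaX_indep (b m) (b (m + n)%N) (b (m + n).+1)).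
- rewrite IH// => j /andP[mj jn]; apply: sE.
  by rewrite mj addnS ltnW.
- by apply: bm; rewrite leq_addr.
- apply: sigmaX_bigcap => // j /andP[mj jn]; apply: sE.
  by rewrite mj addnS ltnW.
- by apply: sE; rewrite leq_addr addnS/=.
Qed.

End Independence.

(** * Second moments and the maximal inequality *)

Section SecondMoment.
Context (d : measure_display) (T : measurableType d) (R : realType)
  (P : probability T R).

Lemma Lfun2_of_sqr (U : {RV P >-> R}) (v : R) :
  ('E_P[fun w => (U w ^+ 2)%R] = v%:E)%E -> (U : T -> R) \in Lfun P 2%:E.
Proof.
rewrite unlock => EU; rewrite inE; apply/andP; split; rewrite inE/=.
  exact: measurable_funP.
rewrite /finite_norm (@lty_poweRy _ _ 2)// poweR_Lnorm//.
rewrite (eq_integral (fun w => (U w ^+ 2)%:E)) ?EU ?ltry// => w _ /=.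
by rewrite powR_mulrn// real_normK// num_real.
Qed.

(** Independence says that the joint law of [U] and [V] is the product of their
    laws; Fubini's theorem for this product law then factors the integral of
    the function [(x, y) |-> x * y]. *)
Lemma expectation_mul_indep (U V : {RV P >-> R}) :
  (U : T -> R) \in Lfun P 2%:E -> (V : T -> R) \in Lfun P 2%:E ->
  (forall A B, measurable A -> measurable B ->
    P (U @^-1` A `&` V @^-1` B) = (P (U @^-1` A) * P (V @^-1` B))%E) ->
  ('E_P[(U : T -> R) \* (V : T -> R)] = 'E_P[U] * 'E_P[V])%E.
Proof.
move=> U2 V2 UV.
have Pfin : P setT \is a fin_num := fin_num_measure P _ measurableT.
have /Lfun1_integrable U1 := Lfun_subset12 Pfin U2.
have /Lfun1_integrable V1 := Lfun_subset12 Pfin V2.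
have /Lfun1_integrable UV1 := Lfun2_mul_Lfun1 U2 V2.
pose Z w := (U w, V w).
have mZ : measurable_fun setT Z by apply: measurable_fun_pair => //.
pose f (z : R * R) := z.1 * z.2.
have mf0 : measurable_fun setT f.
  by apply: measurable_funM; [exact: measurable_fst|exact: measurable_snd].
have /measurable_EFinP mf := mf0.
have prodE A : measurable A ->
    (distribution P U \x distribution P V)%E A = pushforward P Z A.
  by move=> mA; apply: product_measure_unique => // B C mB mC; exact: UV.
have prod_int g : (\int[distribution P U \x distribution P V]_z g z =
    \int[pushforward P Z]_z g z)%E.
  by apply: eq_measure_integral => A mA _; exact: prodE.
have intf : (distribution P U \x distribution P V)%E.-integrable setT (EFin \o f).
  apply/integrableP; split => //; rewrite prod_int.
  have /integrableP[_] : (pushforward P Z).-integrable setT (EFin \o f).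
    by apply: integrable_pushforward.
  by [].
have intid : (distribution P V).-integrable setT (EFin : R -> \bar R).
  by apply: integrable_pushforward => //; exact/measurable_EFinP.
have EV : (\int[distribution P V]_y y%:E)%E = 'E_P[V]%E.
  by rewrite unlock integral_distribution//; exact/measurable_EFinP.
have fV : 'E_P[V]%E \is a fin_num.
  by rewrite expectation_fin_num//; exact: Lfun_subset12 Pfin _ V2.
transitivity (\int[(distribution P U \x distribution P V)%E]_z (EFin \o f) z)%E.
  rewrite prod_int unlock integral_pushforward//.
rewrite -integral12_prod_meas1// /fubini_F/=.
under eq_integral => x _.
  rewrite /f/=; under eq_integral do rewrite EFinM.
  rewrite integralZl// EV -(fineK fV).
  over.
rewrite /= integralZr//=; last first.
  by apply: integrable_pushforward => //; exact/measurable_EFinP.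
rewrite fineK//; congr (_ * _)%E.
by rewrite unlock integral_distribution//; exact/measurable_EFinP.
Qed.

End SecondMoment.

Section Increments.
Context (d : measure_display) (T : measurableType d) (R : realType)
  (P : probability T R).
Variable X : nat -> {RV P >-> R}.

Definition incr (a n : nat) (w : T) : R := psum X n w - psum X a w.

Lemma incrS a n w : incr a n.+1 w = incr a n w + X n w.
Proof. by rewrite /incr /psum big_ord_recr/= addrAC. Qed.

Lemma incr0 a : incr a a = cst 0.
Proof. by apply/funext => w; rewrite /incr subrr. Qed.

Lemma measurable_incr_block a c m n : (a <= m)%N -> (m <= n)%N -> (n <= c)%N ->
  measurable_fun setT (incr m n : blockT X a c -> R).
Proof.
move=> am; elim: n => [|n IH] mn nc.
  move: mn; rewrite leqn0 => /eqP ->.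
  by rewrite incr0; exact: measurable_cst.
have [->|mn'] := eqVneq m n.+1.
  by rewrite incr0; exact: measurable_cst.
have {}mn : (m <= n)%N by rewrite -ltnS ltn_neqAle mn'.
have -> : incr m n.+1 = incr m n \+ X n by apply/funext => w; rewrite incrS.
apply: measurable_funD; first exact: IH mn (ltnW nc).
by apply: measurable_coord_block; rewrite (leq_trans am mn).
Qed.

Lemma measurable_incr a n : measurable_fun setT (incr a n).
Proof.
have mpsum m : measurable_fun setT (psum X m).
  elim: m => [|m IH].
    rewrite (_ : psum X 0 = cst 0)//.
    by apply/funext => w; rewrite /psum big_ord0.
  rewrite (_ : psum X m.+1 = fun w => psum X m w + X m w); last first.
    by apply/funext => w; rewrite /psum big_ord_recr.
  by apply: measurable_funD => //; exact: measurable_funP.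
exact: measurable_funB.
Qed.

HB.instance Definition _ a n :=
  isMeasurableFun.Build _ _ _ _ (incr a n) (measurable_incr a n).

Definition large_incr (a n : nat) (b : R) : set T :=
  [set w | b <= `|incr a n w|].

Lemma large_incr_block a c m n b : (a <= m)%N -> (m <= n)%N -> (n <= c)%N ->
  sigmaX X a c (large_incr m n b).
Proof.
move=> am mn nc; rewrite sigmaXE.
have mi := measurable_incr_block am mn nc.
rewrite (_ : large_incr m n b =
  (fun w => `|incr m n w|) @^-1` `[b, +oo[); last first.
  by apply/seteqP; split => w; rewrite /large_incr/= in_itv/= andbT.
rewrite -[_ @^-1` _]setTI; apply: measurableT_comp => //.
Qed.

Lemma measurable_large_incr a n b : measurable (large_incr a n b).
Proof.
rewrite (_ : large_incr a n b = (fun w => `|incr a n w|) @^-1` `[b, +oo[); last first.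
  by apply/seteqP; split => w; rewrite /large_incr/= in_itv/= andbT.
by rewrite -[_ @^-1` _]setTI; apply: measurableT_comp => //.
Qed.

Variable sigma : nat -> R.
Hypotheses (indX : mutually_independent X) (meanX : forall j, ('E_P[X j] = 0)%E)
    (varX : forall j, ('E_P[fun w => (X j w ^+ 2)%R] = (sigma j ^+ 2)%:E)%E).

Let X2 j : (X j : T -> R) \in Lfun P 2%:E.
Proof. exact: Lfun2_of_sqr (varX j). Qed.

Let Lfun21 (U : T -> R) : U \in Lfun P 2%:E -> U \in Lfun P 1.
Proof. by apply: Lfun_subset12; exact: fin_num_measure. Qed.

Lemma sdev_sqr n : sdev sigma n ^+ 2 = \sum_(i < n) sigma i ^+ 2.
Proof. by rewrite sqr_sqrtr// sumr_ge0// => i _; exact: sqr_ge0. Qed.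

Lemma sdev_sqrS n : sdev sigma n.+1 ^+ 2 = sdev sigma n ^+ 2 + sigma n ^+ 2.
Proof. by rewrite !sdev_sqr big_ord_recr. Qed.

(** The new variable is orthogonal to the increment before it, as they live on
    disjoint ranges of coordinates and are centred. *)
Lemma incr_moments a n : (a <= n)%N ->
  [/\ incr a n \in Lfun P 2%:E, ('E_P[incr a n] = 0)%E &
   ('V_P[incr a n] = (sdev sigma n ^+ 2 - sdev sigma a ^+ 2)%:E)%E].
Proof.
elim: n => [|n IH] an.
  move: an; rewrite leqn0 => /eqP ->; rewrite subrr.
  by rewrite incr0; split; [exact: Lfun_cst|exact: expectation_cst|exact: variance_cst].
have [->|an'] := eqVneq a n.+1.
  rewrite subrr.
  by rewrite incr0; split; [exact: Lfun_cst|exact: expectation_cst|exact: variance_cst].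
have {}an : (a <= n)%N by rewrite -ltnS ltn_neqAle an'.
have [I2 IE IV] := IH an.
have -> : incr a n.+1 = incr a n \+ X n by apply/funext => w; rewrite incrS.
split.
- by rewrite rpredD ?lee1n//=.
- by rewrite expectationD ?IE ?meanX ?adde0//; exact: Lfun21.
rewrite varianceD// IV varianceE// meanX expe2 mul0e sube0.
rewrite (_ : 'E_P[_] = (sigma n ^+ 2)%:E)%E; last by rewrite -varX.
rewrite covarianceE ?IE ?meanX ?mule0 ?sube0; [|exact: Lfun21|exact: Lfun21|
  exact: Lfun2_mul_Lfun1].
rewrite (_ : 'E_P[_] = 0)%E ?mule0 ?adde0; last first.
  rewrite (expectation_mul_indep I2 (X2 n)) ?IE ?mul0e// => A B mA mB.
  have sA : sigmaX X a n (incr a n @^-1` A).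
    rewrite sigmaXE -[_ @^-1` _]setTI.
    exact: (measurable_incr_block (leqnn a) an (leqnn n)).
  have sB : sigmaX X n n.+1 (X n @^-1` B).
    by apply: sub_sigma_algebra; exists n, B; rewrite leqnn ltnS leqnn.
  have mA' := sigmaX_measurable sA; have mB' := sigmaX_measurable sB.
  by rewrite !prE -?EFinM ?(sigmaX_indep indX an sA sB)//; exact: measurableI.
by rewrite -EFinD sdev_sqrS addrAC.
Qed.

Lemma pr_large_incr a n b : (a <= n)%N -> 0 < b ->
  pr P (large_incr a n b) <= (sdev sigma n ^+ 2 - sdev sigma a ^+ 2) / b ^+ 2.
Proof.
move=> an b0; have [_ IE IV] := incr_moments an.
rewrite -lee_fin -prE; last exact: measurable_large_incr.
have := chebyshev (incr a n : {RV P >-> R}) b0.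
rewrite IV IE /= -EFinM mulrC.
by under eq_fun do rewrite subr0.
Qed.

Lemma sdev_le m n : (m <= n)%N -> sdev sigma m <= sdev sigma n.
Proof.
move=> mn; rewrite -ler_sqr ?nnegrE ?sqrtr_ge0//; elim: n mn => [|n IH] mn.
  by move: mn; rewrite leqn0 => /eqP ->.
have [->//|mn'] := eqVneq m n.+1.
by rewrite sdev_sqrS (le_trans (IH _)) ?lerDl ?sqr_ge0// -ltnS ltn_neqAle mn'.
Qed.

Definition large_excursion (a c : nat) (b : R) : set T :=
  \big[setU/set0]_(a <= n < c.+1) large_incr a n b.

Lemma large_excursion_block a c b : sigmaX X a c (large_excursion a c b).
Proof.
rewrite sigmaXE /large_excursion big_nat_cond; apply: bigsetU_measurable => n.
rewrite andbT ltnS => /andP[an nc]; exact: large_incr_block.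
Qed.

(** Ottaviani's inequality. At the first time [m] when the increment from [a]
    reaches [2 * b], the increment from [m] to [c] is independent of the past
    and, by Chebyshev, smaller than [b] with probability at least 1/2; when it
    is, the increment from [a] to [c] is still at least [b]. So the excursion is
    at most twice as likely as a large final increment. *)
Lemma pr_large_excursion a c b : (a <= c)%N -> 0 < b ->
  (sdev sigma c ^+ 2 - sdev sigma a ^+ 2) / b ^+ 2 <= 2^-1 ->
  pr P (large_excursion a c (2 * b)) <=
    2 * ((sdev sigma c ^+ 2 - sdev sigma a ^+ 2) / b ^+ 2).
Proof.
move=> ac b0 small; set F := large_incr a c b.
have mF : measurable F by exact: measurable_large_incr.
pose M m := \big[setU/set0]_(a <= n < m) large_incr a n (2 * b).
have sM m : (a <= m)%N -> sigmaX X a m (M m).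
  move=> am; rewrite sigmaXE /M big_nat_cond; apply: bigsetU_measurable => n.
  by rewrite andbT => /andP[an nc]; apply: large_incr_block => //; exact: ltnW.
have mM m : (a <= m)%N -> measurable (M m).
  by move=> am; exact: sigmaX_measurable (sM m am).
suff H m : (a <= m <= c.+1)%N -> pr P (M m) <= 2 * pr P (M m `&` F).
  apply: (le_trans (H c.+1 _)); first by rewrite (leqW ac) leqnn.
  rewrite ler_pM2l//; apply: le_trans (pr_large_incr ac b0).
  apply: pr_le => //.
  by apply: measurableI => //; exact: mM (leqW ac).
elim: m => [|m IH] /andP[am mc].
  by rewrite /M big_geq// set0I /pr measure0 mulr0.
have [am'|am'] := eqVneq a m.+1.
  by rewrite /M am' big_geq// set0I /pr measure0 mulr0.
have {}am : (a <= m)%N by lia.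
(* The excursion starts exactly at time [m]. *)
pose A := large_incr a m (2 * b) `\` M m.
have sA : sigmaX X a m A.
  rewrite sigmaXE; apply: measurableD; last exact: sM.
  exact: large_incr_block.
have mA := sigmaX_measurable sA.
have MS : M m.+1 = M m `|` A.
  by rewrite /M big_nat_recr//= /A setDE setUIr setUCr setIT.
have MA0 : M m `&` A = set0 by rewrite /A setDE setIA setIAC setICr set0I.
pose S := ~` large_incr m c b.
have sS : sigmaX X m c S.
  by rewrite sigmaXE; apply: measurableC; apply: large_incr_block => //; lia.
have mS := sigmaX_measurable sS.
have S2 : 2^-1 <= pr P S.
  rewrite prC; last exact: measurable_large_incr.
  suff : pr P (large_incr m c b) <= 2^-1 by lra.
  apply: le_trans small; apply: (le_trans (pr_large_incr _ b0)); first by lia.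
  rewrite ler_pM2r ?invr_gt0 ?exprn_gt0// lerD2l lerN2.
  by rewrite ler_sqr ?nnegrE ?sqrtr_ge0// sdev_le.
have AS : pr P A * pr P S <= pr P (A `&` F).
  rewrite -(sigmaX_indep indX am sA sS); apply: pr_le.
  - exact: measurableI.
  - exact: measurableI.
  - move=> w [Aw Sw]; split => //; case: Aw => + _.
    move: Sw; rewrite /S /F /large_incr/= => /negP; rewrite -ltNge.
    have -> : incr a c w = incr a m w + incr m c w by rewrite /incr; lra.
    move=> h1 h2; have := lerB_normD (incr a m w) (incr m c w); lra.
rewrite MS setIUl (prU P (mM m am) mA MA0) prU; last 3 first.
- by apply: measurableI => //; exact: mM.
- exact: measurableI.
- by rewrite setIACA MA0 set0I.
have {}IH : pr P (M m) <= 2 * pr P (M m `&` F) by rewrite IH// am ltnW.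
have := pr_ge0 P A; nra.
Qed.

End Increments.

(** * Geometric blocks and windows *)

Section GeometricSequence.
Context (R : realType).

(** The next cut is the first index at which [s] exceeds twice its current
    value; the bound on ratios limits the overshoot. *)
Lemma geometric_blocks (s : nat -> R) (C : R) (n0 : nat) :
  (forall n, 0 <= s n) -> {homo s : m n / (m <= n)%N >-> m <= n} ->
  s n @[n --> \oo] --> +oo ->
  (forall j, 0 < s j -> s j.+1 / s j <= C) ->
  exists b : nat -> nat, [/\ (n0 <= b 0)%N, 1 <= s (b 0),
    forall i, (b i < b i.+1)%N &
    forall i, 2 * s (b i) < s (b i.+1) <= 2 * C * s (b i)].
Proof.
move=> s_ge0 s_nd s_y ratio.
have exceeds a n : exists m, (n < m)%N && (a < s m).
  have /cvgryPge/(_ (a + 1))[m0 _ Hm] := s_y.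
  exists (maxn m0 n.+1); rewrite leq_maxr/=.
  by have := Hm (maxn m0 n.+1) (leq_maxl _ _); rewrite /= ; lra.
have C_ge0 : 0 <= C.
  have [n /andP[_ sn]] := exceeds 0 0%N.
  by apply: le_trans (ratio n sn); rewrite divr_ge0.
have next n : exists m, (n < m)%N /\ (0 < s n -> 2 * s n < s m <= 2 * C * s n).
  case: (ex_minnP (exceeds (2 * s n) n)) => m /andP[nm sm] m_min.
  exists m; split => // sn; rewrite sm/=.
  case: m nm sm m_min => // m; rewrite ltnS => nm sm m_min.
  have sm_le : 0 < s m -> s m.+1 <= C * s m.
    by move=> s0; rewrite -ler_pdivrMr//; exact: ratio.
  have [nm'|nm'] := eqVneq n m.
    by rewrite -nm' in sm_le *; have := sm_le sn; nra.
  have sm2 : s m <= 2 * s n.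
    rewrite leNgt; apply/negP => sm'.
    by have := m_min m; rewrite sm' ltnn ltn_neqAle nm' nm => /(_ isT).
  have sm0 : 0 < s m by apply: (lt_le_trans sn); exact: s_nd.
  by have := sm_le sm0; nra.
have [g Hg] := choice next.
have [n1 /andP[n01 sn1]] := exceeds 1 n0.
pose b i := iter i g n1.
have sb i : 1 <= s (b i).
  elim: i => [|i IH]; first exact: ltW.
  by have [_ /(_ (lt_le_trans ltr01 IH)) /andP[+ _]] := Hg (b i); rewrite /=; lra.
exists b; split => [||i|i].
- exact: ltnW.
- exact: ltW.
- by have [] := Hg (b i).
- by have [_] := Hg (b i); apply; exact: lt_le_trans (sb i).
Qed.

(** In what follows [S k] plays the part of the variance at the k-th cut. *)
Variables (S : nat -> R) (D : R).
Hypotheses (S0 : 1 <= S 0%N) (S4 : forall k, 4 * S k < S k.+1)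
  (SD : forall k, S k.+1 <= D * S k).

Let Sge1 k : 1 <= S k.
Proof. by elim: k => // k IH; have := S4 k; lra. Qed.

Let D4 : 4 <= D.
Proof.
have := S4 0%N; have := SD 0%N; have := S0 => h1 h2 h3.
have : 4 * S 0%N < D * S 0%N by lra.
by rewrite ltr_pM2r; [exact: ltW|lra].
Qed.

Lemma geometric_lower k m : 4 ^+ m * S k <= S (k + m)%N.
Proof.
elim: m => [|m IH]; first by rewrite mul1r addn0.
by rewrite addnS exprS; have := S4 (k + m)%N; lra.
Qed.

Lemma geometric_upper k m : S (k + m)%N <= D ^+ m * S k.
Proof.
elim: m => [|m IH]; first by rewrite mul1r addn0.
rewrite addnS exprS -mulrA; apply: (le_trans (SD _)).
by rewrite ler_pM2l//; apply: lt_le_trans D4.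
Qed.

Lemma geometric_nd : {homo S : k m / (k <= m)%N >-> k <= m}.
Proof.
move=> k m km; rewrite -(subnKC km); apply: le_trans (geometric_lower _ _).
by rewrite ler_peMl ?exprn_ege1//; [have := Sge1 k; lra|lra].
Qed.

Let split_index a b m : (a + (2 * m + 3) * b = (a + b) + (2 * m + 2) * b)%N.
Proof. by clear; lia. Qed.

Let split_expr b m : (4 : R) ^+ ((2 * m + 2) * b) = (16 ^+ b) ^+ m * 16 ^+ b.
Proof.
rewrite (_ : (16 : R) = 4 ^+ 2); last by rewrite expr2 -natrM.
rewrite -!exprM -exprD; congr (_ ^+ _).
by rewrite mulnDl -?mulnA (mulnC m).
Qed.

Let exp2_ge r : (r < 2 ^ r)%N. Proof. exact: ltn_expl. Qed.

(** From block [i + r] to block [i + A r] the variance is multiplied by at least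
    [4 ^+ ((A - 1) r)]. A starting point [i] of order [A r 2^r] makes the
    logarithm of [N], taken just above [S (i + r)], at most [8 ^+ r] for large
    [r]; so [A - 1 = 2 m + 2] with [m >= M] is enough to leave the window
    behind, as [4 ^+ (2 m r) = 16 ^+ (m r)]. *)
Lemma small_window (M : R) : 0 < M -> exists A r1 : nat, (0 < A)%N /\
  forall r i, (r1 <= r)%N -> (i <= 2 ^ r * (A * r))%N ->
  exists N : nat, [/\ (r <= N)%N, S (i + r)%N < N%:R &
    N%:R * (ln N%:R `^ M) < S (i + A * r)%N].
Proof.
move=> M0; pose Mn := (Num.truncn M).+1.
have MMn : M <= Mn%:R by apply: ltW; exact: truncnS_gt.
pose A := (2 * Mn + 3)%N.
pose g := ln (2 * D * S 0%N).
have D0 : 0 < D by have := D4; lra.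
have DS1 : 1 <= 2 * D * S 0%N by have := D4; have := S0; nra.
have DSp : 0 < 2 * D * S 0%N by lra.
have g0 : 0 <= g by exact: ln_ge0.
pose r1 := (Num.truncn (A.+1%:R * g)).+1.
exists A, r1; split => // r i r1r ir.
pose N := (Num.truncn (S (i + r)%N)).+1.
have Sr1 := Sge1 (i + r)%N.
have SN : S (i + r)%N < N%:R by exact: truncnS_gt.
have NS : N%:R <= 2 * S (i + r)%N.
  have /andP[+ _] := truncn_itv (le_trans ler01 Sr1).
  by rewrite /N -natr1; lra.
have r0 : (0 < r)%N by apply: leq_trans r1r.
have rN : (r <= N)%N.
  have : (2 ^ r)%:R <= S (i + r)%N.
    apply: (le_trans _ (geometric_lower _ _)); rewrite natrX.
    apply: le_trans (ler_peMr _ (Sge1 i)); last exact: exprn_ge0.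
    by apply: lerXn2r; rewrite ?nnegrE ?ler_nat.
  move=> /le_lt_trans/(_ SN); rewrite ltr_nat => rN.
  by apply: ltnW (ltn_trans (exp2_ge r) rN).
have lnN0 : 0 <= ln N%:R :> R by apply: ln_ge0; lra.
have lnN : ln N%:R <= (i + r).+1%:R * g.
  have -> : (i + r).+1%:R * g = ln ((2 * D * S 0%N) ^+ (i + r).+1).
    by rewrite lnXn// mulr_natl.
  rewrite ler_ln ?posrE; last 2 first.
  - by apply: lt_trans SN; lra.
  - exact: exprn_gt0.
  have := geometric_upper 0 (i + r); rewrite add0n => h.
  have h2 : D ^+ (i + r) <= (2 * D * S 0%N) ^+ (i + r).
    apply: lerXn2r; rewrite ?nnegrE ?ltW//.
    by have := S0; have := D0; nra.
  have e2 : 0 < D ^+ (i + r) by exact: exprn_gt0.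
  rewrite exprS; move: h h2 e2; set x := D ^+ _; set y := _ ^+ (i + r).
  move=> h h2 e2.
  have h3 : D * S 0%N * x <= D * S 0%N * y by apply: ler_wpM2l => //; lra.
  have h4 : S 0%N * x <= D * S 0%N * x.
    by rewrite ler_pM2r// ler_peMl; have := S0; have := D4; lra.
  by lra.
have lnN8 : ln N%:R <= 8 ^+ r :> R.
  apply: (le_trans lnN).
  have h1 : ((i + r).+1 <= A.+1 * (2 ^ r * 2 ^ r))%N.
    rewrite mulSn -addnS addnC; apply: leq_add.
      by apply: leq_trans (exp2_ge r) _; rewrite leq_pmulr// expn_gt0.
    apply: (leq_trans ir); rewrite mulnCA leq_mul2l leq_mul2l.
    by rewrite (ltnW (exp2_ge r)) !orbT.
  apply: (@le_trans _ _ ((A.+1 * (2 ^ r * 2 ^ r))%N%:R * g)).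
    by apply: ler_wpM2r => //; rewrite ler_nat.
  have -> : (8 : R) ^+ r = (2 ^ r * 2 ^ r)%N%:R * (2 ^ r)%N%:R.
    by rewrite -natrM -!expnMn natrX; congr (_ ^+ r); rewrite -natrM.
  rewrite mulnC natrM -mulrA ler_pM2l; last by rewrite ltr0n muln_gt0 expn_gt0.
  apply: ltW; apply: lt_le_trans (truncnS_gt _) _.
  by rewrite ler_nat; apply: (leq_trans r1r); exact: ltnW.
exists N; split => //.
have r8 : 1 <= 8 ^+ r :> R by apply: exprn_ege1; lra.
have f_le : ln N%:R `^ M <= (8 ^+ r) ^+ Mn.
  apply: (@le_trans _ _ ((8 ^+ r) `^ M)).
    by apply: ge0_ler_powR; rewrite ?nnegrE//; lra.
  by rewrite -[leRHS]powR_mulrn; [exact: ler_powR|lra].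
rewrite /A split_index.
apply: lt_le_trans (geometric_lower _ _).
rewrite split_expr.
have h1 : (8 ^+ r) ^+ Mn <= (16 ^+ r) ^+ Mn :> R.
  by rewrite -!exprM; apply: lerXn2r; rewrite ?nnegrE; lra.
have h2 : 1 <= (8 ^+ r) ^+ Mn :> R by exact: exprn_ege1.
have h3 : 16 <= 16 ^+ r :> R.
  by rewrite -[leLHS]expr1; apply: ler_weXn2l => //; lra.
have f0 : 0 <= ln N%:R `^ M by exact: powR_ge0.
apply: (@le_lt_trans _ _ (2 * S (i + r)%N * (16 ^+ r) ^+ Mn)).
  by apply: ler_pM => //; lra.
by rewrite mulrC mulrA ltr_pM2r//; nra.
Qed.

(** Let [i] be the first block end beyond [N]. Since [S] grows at least like
    [4 ^+ i], [i] is of order [ln N], and [A r] further blocks with [2 ^ r] of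
    order [i] multiply the variance by at most [D ^+ ((A + 1) r)], a fixed power
    of [2 ^ r], hence of [ln N]. This is beaten by a power that tends to
    infinity. *)
Lemma large_window (A r0 : nat) (xi : nat -> R) :
  xi N @[N --> \oo] --> +oo ->
  exists N0 : nat, forall N, (N0 <= N)%N -> exists r i : nat,
    [/\ (r0 <= r)%N, (i < 2 ^ r)%N, N%:R < S i &
        S (i + A * r)%N <= N%:R * (ln N%:R `^ xi N)].
Proof.
move=> xi_y.
have D0 : 0 < D by have := D4; lra.
pose E := (Num.truncn (D ^+ A.+1)).+1.
have DE : D ^+ A.+1 <= 2 ^+ E.
  apply: (le_trans (ltW (truncnS_gt _))).
  by rewrite -natrX ler_nat; exact: ltnW.
have /cvgryPge/(_ (2 * E)%:R)[N1 _ HN1] := xi_y.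
pose c : R := (ln 4)^-1.
have ln4 : 0 < ln 4 :> R by apply: ln_gt0; lra.
have c0 : 0 < c by rewrite invr_gt0.
(* From [N2] on, twice the bound on [i] is at most the square of [ln N]. *)
pose N2 := (Num.truncn (expR (2 * c + 2))).+1.
pose N3 := (Num.truncn (S (2 ^ r0))).+1.
exists (maxn N1 (maxn N2 N3)) => N; rewrite !geq_max => /and3P[N1N N2N N3N].
have xiN : (2 * E)%:R <= xi N by exact: HN1.
have Npos : 0 < N%:R :> R by rewrite ltr0n; exact: leq_trans N3N.
have lnN : 2 * c + 2 <= ln N%:R.
  rewrite -[leLHS]expRK ler_ln ?posrE ?expR_gt0//.
  by apply: (le_trans (ltW (truncnS_gt _))); rewrite ler_nat.
have SN3 : S (2 ^ r0) <= N%:R.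
  by apply: (le_trans (ltW (truncnS_gt _))); rewrite ler_nat.
have exS : exists i, N%:R < S i.
  exists N; apply: lt_le_trans (geometric_lower 0 N).
  have := exp2_ge N; rewrite -(ltr_nat R) natrX => h.
  have h2 : 2 ^+ N <= 4 ^+ N :> R by apply: lerXn2r; rewrite ?nnegrE; lra.
  by have := S0; nra.
case: (ex_minnP exS) => i iN i_min.
have i_gt : (2 ^ r0 < i)%N.
  by rewrite ltnNge; apply/negP => /geometric_nd; lra.
case: i iN i_min i_gt => // i iN i_min i_gt.
have SiN : S i <= N%:R by rewrite leNgt; apply/negP => /i_min; rewrite ltnn.
have i_ln : i%:R <= c * ln N%:R.
  rewrite mulrC ler_pdivlMr// mulr_natl -lnXn ?ler_ln ?posrE ?exprn_gt0//.
  apply: le_trans SiN; apply: le_trans (geometric_lower 0 i).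
  by rewrite ler_peMr ?exprn_ge0//; lra.
pose r := (trunc_log 2 i.+1).+1.
have /andP[r_lo r_hi] := @trunc_log_bounds 2 i.+1 isT isT.
exists r, i.+1; split => //.
- apply: ltnW; rewrite -(@ltn_exp2l 2)//; exact: ltn_trans i_gt r_hi.
rewrite addSnnS.
apply: (le_trans (geometric_upper _ _)); rewrite mulrC.
apply: ler_pM => //; first exact: le_trans ler01 (Sge1 i).
  by rewrite exprn_ge0// ltW.
have lnN1 : 1 <= ln N%:R :> R by lra.
apply: (@le_trans _ _ (D ^+ (A.+1 * r))).
  apply: ler_weXn2l; first by have := D4; lra.
  by rewrite mulSn addnC -addn1 leq_add2l.
rewrite exprM; apply: (@le_trans _ _ ((2 ^+ E) ^+ r)).
  by apply: lerXn2r => //; rewrite nnegrE ?exprn_ge0// ltW.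
rewrite exprAC; apply: (@le_trans _ _ ((ln N%:R ^+ 2) ^+ E)).
  apply: lerXn2r; rewrite ?nnegrE ?exprn_ge0//; first lra.
  apply: (@le_trans _ _ (2 * i.+1%:R)).
    by rewrite /r exprS ler_pM2l// -natrX ler_nat.
  by rewrite -natr1; nra.
rewrite -exprM -powR_mulrn; last lra.
exact: ler_powR.
Qed.

End GeometricSequence.

(** * Borel-Cantelli and lower limits *)

Section BernoulliInequality.
Context (R : realType).

Lemma bernoulli (x : R) n : -1 <= x -> 1 + n%:R * x <= (1 + x) ^+ n.
Proof.
move=> x1; elim: n => [|n IH]; first by rewrite mul0r addr0.
rewrite exprS -natr1; apply: (@le_trans _ _ ((1 + x) * (1 + n%:R * x))).
  have n0 : 0 <= n%:R :> R by [].
  have := mulr_ge0 n0 (sqr_ge0 x); rewrite expr2; lra.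
by rewrite ler_wpM2l//; lra.
Qed.

(** By Bernoulli's inequality [n%:R * x <= (1 + x) ^+ n], and
    [(1 - x) * (1 + x) <= 1]. *)
Lemma expr1B_mul_le1 (x : R) n : 0 <= x <= 1 -> (1 - x) ^+ n * (n%:R * x) <= 1.
Proof.
move=> /andP[x0 x1].
have h : n%:R * x <= (1 + x) ^+ n.
  by apply: le_trans (bernoulli n _); lra.
apply: (@le_trans _ _ ((1 - x) ^+ n * (1 + x) ^+ n)).
  by rewrite ler_wpM2l// exprn_ge0//; lra.
rewrite -exprMn exprn_ile1//; nra.
Qed.

End BernoulliInequality.

Section AlmostSure.
Context (d : measure_display) (T : measurableType d) (R : realType)
  (P : probability T R).

Lemma borel_cantelli_geometric (Bad : nat -> set T) (K q : R) :
  (forall r, measurable (Bad r)) -> 0 < q < 1 ->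
  (forall r, pr P (Bad r) <= K * q ^+ r) ->
  {ae P, forall w, exists r0, forall r, (r0 <= r)%N -> ~ Bad r w}.
Proof.
move=> mBad /andP[q0 q1] PBad.
have mL : measurable (lim_sup_set Bad).
  by apply: bigcap_measurable => // n _; exact: bigcup_measurable.
have K0 : 0 <= K.
  by have := le_trans (pr_ge0 P _) (PBad 0%N); rewrite expr0 mulr1.
have L0 : P (lim_sup_set Bad) = 0%E.
  apply: lim_sup_set_cvg0 => //.
  apply: (@le_lt_trans _ _ (K / (1 - q))%:E); last exact: ltry.
  apply: lime_le; first by apply: is_cvg_nneseries.
  have PBad' r : (P (Bad r) <= (K * q ^+ r)%:E)%E.
    by rewrite prE// lee_fin.
  apply: nearW => n; apply: (le_trans (lee_sum _ (fun r _ => PBad' r))).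
  rewrite sumEFin lee_fin.
  have := @geometric_le_lim R n K q K0 q0; rewrite /series/=; apply.
  by rewrite ger0_norm// ltW.
apply: (@negligibleS _ _ _ _ (lim_sup_set Bad)); last exact/negligibleP.
move=> w /= H n _; apply: contrapT => Hn; apply: H; exists n => r nr Bw.
by apply: Hn; exists r.
Qed.

Lemma limn_einf_ltpinfty (u : nat -> \bar R) (K : R) :
  (forall n, exists2 m, (n <= m)%N & (u m <= K%:E)%E) -> (limn_einf u < +oo)%E.
Proof.
move=> uK; apply: (@le_lt_trans _ _ K%:E); last exact: ltry.
rewrite limn_einf_lim; apply: lime_le; first exact: is_cvg_einfs.
apply: nearW => n; have [m nm um] := uK n; apply: le_trans um.
by apply: ereal_inf_lbound; exists m.
Qed.

Lemma limn_einf_pinfty (u : nat -> \bar R) :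
  (forall K : nat, exists n, forall m, (n <= m)%N -> (K%:R%:E <= u m)%E) ->
  limn_einf u = +oo%E.
Proof.
move=> uK; suff /cvg_limn_einf_sup[-> //] : u n @[n --> \oo] --> +oo%E.
apply/cvgeyPge => B; have [n Hn] := uK (Num.truncn B).+1.
exists n => // m /= nm; apply: le_trans (Hn m nm).
by rewrite lee_fin; apply: ltW; exact: truncnS_gt.
Qed.

End AlmostSure.

(** * Runs of blocks and the two regimes *)

Section BigSets.
Context (T : Type).
Implicit Types (F : nat -> set T) (w : T).

Lemma in_bigsetU F n w :
  (\big[setU/set0]_(i < n) F i) w <-> exists2 i, (i < n)%N & F i w.
Proof. by rewrite -bigcup_mkord. Qed.

Lemma in_bigsetU_nat F m n w :
  (\big[setU/set0]_(m <= i < n) F i) w <-> exists2 i, (m <= i < n)%N & F i w.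
Proof.
rewrite -bigcup_seq; split => -[i] /=; first by rewrite mem_index_iota; exists i.
by move=> imn Fw; exists i => //=; rewrite mem_index_iota.
Qed.

Lemma in_bigsetI_nat F m n w :
  (\big[setI/setT]_(m <= i < n) F i) w <-> (forall i, (m <= i < n)%N -> F i w).
Proof.
rewrite -bigcap_seq; split => H i /=.
  by move=> imn; apply: H => /=; rewrite mem_index_iota.
by rewrite mem_index_iota; exact: H.
Qed.

End BigSets.

Section Regimes.
Context (d : measure_display) (T : measurableType d) (R : realType)
  (P : probability T R).
Variables (X : nat -> {RV P >-> R}) (sigma : nat -> R).
Hypotheses (indX : mutually_independent X) (meanX : forall j, ('E_P[X j] = 0)%E)
    (varX : forall j, ('E_P[fun w => (X j w ^+ 2)%R] = (sigma j ^+ 2)%:E)%E).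
Variables (C : R) (b : nat -> nat).
Let s (n : nat) : R := sdev sigma n.
Let S (k : nat) : R := s (b k) ^+ 2.
Hypotheses (s_b0 : 1 <= s (b 0%N)) (b_lt : forall i, (b i < b i.+1)%N)
  (s_b : forall i, 2 * s (b i) < s (b i.+1) <= 2 * C * s (b i)).

Let b_nd : {homo b : i j / (i <= j)%N}.
Proof. by apply: homo_leq => // [? ? ? /leq_trans|i]; [apply|exact: ltnW]. Qed.

Let s_ge0 n : 0 <= s n. Proof. exact: sqrtr_ge0. Qed.

Let s_nd m n : (m <= n)%N -> s m <= s n. Proof. exact: sdev_le. Qed.

Let s_b_gt0 i : 0 < s (b i).
Proof.
apply: (lt_le_trans ltr01); apply: (le_trans s_b0).
by apply: s_nd; exact: b_nd.
Qed.

Let S0 : 1 <= S 0. Proof. by rewrite /S exprn_ege1. Qed.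

Let S4 k : 4 * S k < S k.+1.
Proof.
have /andP[+ _] := s_b k; have := s_b_gt0 k; rewrite /S !expr2 => h1 h2; nra.
Qed.

Let SD k : S k.+1 <= (2 * C) ^+ 2 * S k.
Proof.
have /andP[_ h] := s_b k; rewrite /S -exprMn.
by apply: lerXn2r; rewrite ?nnegrE// (le_trans _ h).
Qed.

Let window_ge (f : nat -> R) w N n : N%:R < s n ^+ 2 -> s n ^+ 2 <= N%:R * f N ->
  ((`|psum X n w| / s n)%:E <= window_max X sigma f w N)%E.
Proof.
move=> h1 h2; apply: ereal_sup_ubound; exists n => //=.
by rewrite h1 h2.
Qed.

Section LargeWindows.
Variables (lam c : R).
Hypotheses (lam0 : 0 < lam) (c0 : 0 < c).

Let G j : set T := large_incr X (b j) (b j.+1) (lam * s (b j.+1)).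

Hypothesis G_ge : forall j, c <= pr P (G j).

Let mG j : measurable (G j). Proof. exact: measurable_large_incr. Qed.

Lemma pr_no_large_incr i n :
  pr P (\big[setI/setT]_(i <= j < i + n) ~` G j) <= (1 - c) ^+ n.
Proof.
have Gb j : sigmaX X (b j) (b j.+1) (~` G j).
  rewrite sigmaXE; apply: measurableC; apply: large_incr_block => //.
  exact: ltnW.
rewrite (pr_block_bigcap indX b_nd) => [|j _]; last exact: Gb.
have -> : (1 - c) ^+ n = \prod_(i <= j < i + n) (1 - c).
  by rewrite prodr_const_nat addKn.
apply: ler_prod => j _; rewrite pr_ge0/= prC//.
by have := G_ge j; lra.
Qed.

(** At each level [r] there are [2 ^ r] starting points, and [A] is such that a
    run of [A r] blocks without a large increment has probability at most
    [4^-1 ^+ r]. A window that contains a block with a large increment contains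
    both of its ends, and at one of them the partial sum is large. *)
Lemma window_max_ge_half (xi : nat -> R) : xi N @[N --> \oo] --> +oo ->
  {ae P, forall w, exists N0, forall N, (N0 <= N)%N ->
    ((lam / 2)%:E <= window_max X sigma (fun N => powR (ln N%:R) (xi N)) w N)%E}.
Proof.
move=> xi_y.
have c1 : c <= 1 by apply: (le_trans (G_ge 0)); exact: pr_le1.
have [A A4] : exists A, (1 - c) ^+ A <= 4^-1.
  have q0 : 0 <= 1 - c by lra.
  have q1 : `|1 - c| < 1 by rewrite ger0_norm//; have := c0; lra.
  have /cvgrPdist_le/(_ 4^-1)[|A _ HA] := cvg_expr q1; first by rewrite invr_gt0.
  exists A; have := HA A (leqnn A); rewrite /= sub0r normrN => h.
  exact: le_trans (ler_norm _) h.
pose none i r := \big[setI/setT]_(i <= j < i + A * r) ~` G j.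
have mnone i r : measurable (none i r).
  by apply: bigsetI_measurable => j _; exact: measurableC.
pose Bad r := \big[setU/set0]_(i < 2 ^ r) none i r.
have mBad r : measurable (Bad r).
  by apply: bigsetU_measurable => i _; exact: mnone.
have := @borel_cantelli_geometric _ _ _ P Bad 1 2^-1 mBad.
case=> [|r|Z [mZ PZ HZ]].
- by apply/andP; split; lra.
- have := @pr_bigcup_le _ _ _ P (fun i => none i r) (2 ^ r) (4^-1 ^+ r).
  rewrite mul1r => h; apply: le_trans (h _ _) _ => [i _|i _|].
  + exact: mnone.
  + apply: (le_trans (pr_no_large_incr _ _)); rewrite exprM.
    by apply: lerXn2r; rewrite ?nnegrE ?exprn_ge0//; lra.
  + by rewrite natrX -exprMn (_ : 2 * 4^-1 = 2^-1)//; lra.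
exists Z; split => //; apply: subset_trans HZ => w /= Hw Hr; apply: Hw.
have [r0 Hr0] := Hr.
have [N0 HN0] := large_window S0 S4 SD A r0 xi_y.
exists N0 => N /HN0[r [i [r0r ir NS SN]]].
have [j] : exists2 j, (i <= j < i + A * r)%N & G j w.
  apply: contrapT => Hj; apply: (Hr0 r r0r).
  apply: (in_bigsetU (fun i => none i r) _ _).2; exists i => //.
  apply: (in_bigsetI_nat (fun j => ~` G j) _ _ _).2 => j ij Gj.
  by apply: Hj; exists j.
move=> /andP[ij jA]; rewrite /G /large_incr /incr/= => Gj.
have in_window k : (i <= k <= i + A * r)%N -> N%:R < s (b k) ^+ 2 /\
    s (b k) ^+ 2 <= N%:R * (ln N%:R `^ xi N).
  move=> /andP[ik kA]; split.
    by apply: (lt_le_trans NS); exact: (geometric_nd S0 S4).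
  by apply: le_trans SN; exact: (geometric_nd S0 S4).
have [j1 j2] : N%:R < s (b j) ^+ 2 /\ s (b j) ^+ 2 <= N%:R * (ln N%:R `^ xi N).
  by apply: in_window; rewrite ij ltnW.
have [j3 j4] : N%:R < s (b j.+1) ^+ 2 /\
    s (b j.+1) ^+ 2 <= N%:R * (ln N%:R `^ xi N).
  by apply: in_window; rewrite jA leqW.
have [h|h] := leP (lam / 2 * s (b j)) `|psum X (b j) w|.
  apply: le_trans (window_ge w j1 j2); rewrite lee_fin ler_pdivlMr//.
apply: le_trans (window_ge w j3 j4); rewrite lee_fin ler_pdivlMr//.
have := ler_normB (psum X (b j.+1) w) (psum X (b j) w).
have sle : s (b j) <= s (b j.+1) by apply: s_nd; exact: ltnW.
have := ler_wpM2l (ltW lam0) sle; lra.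
Qed.

End LargeWindows.

Section BoundedWindows.
Variable A : nat.
Hypothesis A_gt0 : (0 < A)%N.

(** With this threshold a block fails to be quiet with probability at most
    [1 / (4 A)], so [A] quiet blocks in a row have probability at least 3/4. *)
Let kap : R := 32 * A%:R.

Let A_ge1 : 1 <= A%:R :> R. Proof. by rewrite ler1n. Qed.

Let quiet j : set T := ~` large_excursion X (b j) (b j.+1) (kap * s (b j.+1)).

Let quiet_block j : sigmaX X (b j) (b j.+1) (quiet j).
Proof. by rewrite sigmaXE; apply: measurableC; exact: large_excursion_block. Qed.

Let measurable_quiet j : measurable (quiet j).
Proof. exact: sigmaX_measurable (@quiet_block j). Qed.

Lemma pr_quiet j : 1 - (4 * A%:R)^-1 <= pr P (quiet j).
Proof.
have mL : measurable (large_excursion X (b j) (b j.+1) (kap * s (b j.+1))).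
  by apply: sigmaX_measurable; exact: large_excursion_block.
rewrite /quiet prC//.
suff : pr P (large_excursion X (b j) (b j.+1) (kap * s (b j.+1))) <= (4 * A%:R)^-1.
  by lra.
have a1 := A_ge1; have sj := s_b_gt0 j.+1.
(* The maximal inequality is applied at half the threshold. *)
pose h := 16 * A%:R * s (b j.+1).
have h0 : 0 < h by rewrite /h !mulr_gt0//; lra.
have -> : kap * s (b j.+1) = 2 * h by rewrite /kap /h; ring.
have bj : (b j <= b j.+1)%N by exact: ltnW.
have small : (s (b j.+1) ^+ 2 - s (b j) ^+ 2) / h ^+ 2 <= (8 * A%:R)^-1.
  rewrite ler_pdivrMr ?exprn_gt0//.
  have -> : (8 * A%:R)^-1 * h ^+ 2 = 32 * A%:R * s (b j.+1) ^+ 2.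
    by rewrite /h; field; lra.
  have := sqr_ge0 (s (b j)); have := sqr_ge0 (s (b j.+1)).
  move: (_ ^+ 2) (_ ^+ 2) => u v; nra.
apply: le_trans (pr_large_excursion indX meanX varX bj h0 _) _.
  apply: (le_trans small); rewrite lef_pV2 ?posrE; lra.
apply: (@le_trans _ _ (2 * (8 * A%:R)^-1)); first by rewrite ler_pM2l.
by rewrite le_eqVlt; apply/orP; left; apply/eqP; field; lra.
Qed.

Let run i r : set T := \big[setI/setT]_(i <= j < i + A * r) quiet j.

Lemma pr_run i r : (3 / 4) ^+ r <= pr P (run i r).
Proof.
rewrite (pr_block_bigcap indX b_nd) => [|j _]; last exact: quiet_block.
have a1 := A_ge1.
have q0 : 0 <= 1 - (4 * A%:R)^-1 :> R.
  have : (4 * A%:R)^-1 <= 1 :> R by rewrite invf_le1; lra.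
  by lra.
apply: (@le_trans _ _ (\prod_(i <= j < i + A * r) (1 - (4 * A%:R)^-1))).
  rewrite prodr_const_nat addKn exprM; apply: lerXn2r.
  - by rewrite nnegrE; lra.
  - by rewrite nnegrE exprn_ge0.
  - apply: (le_trans _ (bernoulli _ _)); last by lra.
    rewrite mulrN (_ : A%:R * _ = 4^-1); first lra.
    by field; lra.
by apply: ler_prod => j _; rewrite q0 pr_quiet.
Qed.

Let no_run r : set T := \big[setI/setT]_(0 <= t < 0 + 2 ^ r) ~` run (t * (A * r)) r.

Let run_block r t :
  sigmaX X (b (t * (A * r))) (b (t.+1 * (A * r))) (~` run (t * (A * r)) r).
Proof.
rewrite sigmaXE; apply: measurableC; rewrite -sigmaXE mulSn addnC.
by apply: sigmaX_bigcap => // j _; exact: quiet_block.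
Qed.

(** The [2 ^ r] runs use disjoint ranges of blocks, so they are independent,
    and the expected number of those that occur is at least
    [(2 * (3 / 4)) ^+ r]; the probability that none occurs is at most the
    inverse of this number, by [expr1B_mul_le1]. *)
Lemma pr_no_run r : pr P (no_run r) <= (2 / 3) ^+ r.
Proof.
have b'_nd : {homo (fun t => b (t * (A * r))) : i j / (i <= j)%N}.
  by move=> i j ij; apply: b_nd; rewrite leq_mul2r ij orbT.
rewrite (pr_block_bigcap indX b'_nd) => [|t _]; last exact: run_block.
pose x : R := (3 / 4) ^+ r.
have x0 : 0 < x by apply: exprn_gt0; lra.
have x1 : x <= 1 by apply: exprn_ile1; lra.
apply: (@le_trans _ _ ((1 - x) ^+ (2 ^ r))).
  have -> : (1 - x) ^+ (2 ^ r) = \prod_(0 <= t < 0 + 2 ^ r) (1 - x).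
    by rewrite prodr_const_nat addKn.
  apply: ler_prod => t _; rewrite pr_ge0/= prC; last first.
    by apply: bigsetI_measurable => j _; exact: measurable_quiet.
  by rewrite lerD2l lerN2; exact: pr_run.
have := @expr1B_mul_le1 R x (2 ^ r); rewrite (ltW x0) x1 => /(_ isT).
have -> : (2 / 3 : R) ^+ r = ((2 ^ r)%:R * x)^-1.
  by rewrite natrX -exprMn -exprVn; congr (_ ^+ _); lra.
by move=> h; rewrite -[leRHS]mul1r ler_pdivlMr// mulr_gt0// ltr0n expn_gt0.
Qed.

(** The partial sum before block [i] still matters [r] blocks later. *)
Let off i r : set T := large_incr X 0 (b i) (s (b (i + r)%N)).

Lemma pr_off i r : pr P (off i r) <= 4^-1 ^+ r.
Proof.
apply: (le_trans (pr_large_incr indX meanX varX (leq0n _) (s_b_gt0 _))).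
rewrite ler_pdivrMr ?exprn_gt0//; apply: (@le_trans _ _ (S i)).
  by rewrite /S lerBlDr lerDl sqr_ge0.
rewrite exprVn mulrC ler_pdivlMr ?exprn_gt0// mulrC.
exact: (geometric_lower S4).
Qed.

(** Chebyshev's bound on [off] survives the union over the [2 ^ r] starting
    points: [2 ^+ r * 4^-1 ^+ r = 2^-1 ^+ r]. *)
Lemma eventually_good_run : {ae P, forall w, exists r0, forall r, (r0 <= r)%N ->
  exists2 t, (t < 2 ^ r)%N &
    run (t * (A * r)) r w /\ ~ off (t * (A * r)) r w}.
Proof.
pose some_off r := \big[setU/set0]_(t < 2 ^ r) off (t * (A * r)) r.
have moff i r : measurable (off i r) by exact: measurable_large_incr.
have msome r : measurable (some_off r).
  by apply: bigsetU_measurable => t _; exact: moff.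
have mno r : measurable (no_run r).
  by apply: bigsetI_measurable => t _; exact: sigmaX_measurable (@run_block r t).
have mBad r : measurable (no_run r `|` some_off r) by exact: measurableU.
have := @borel_cantelli_geometric _ _ _ P _ 2 (2 / 3) mBad.
case=> [|r|Z [mZ PZ HZ]].
- by apply/andP; split; lra.
- apply: (le_trans (prU_le P (mno r) (msome r))).
  have h1 := pr_no_run r.
  have h2 : pr P (some_off r) <= (2 / 3) ^+ r.
    have := @pr_bigcup_le _ _ _ P (fun t => off (t * (A * r)) r) (2 ^ r) (4^-1 ^+ r).
    move=> h; apply: le_trans (h _ _) _ => [t _|t _|].
    + exact: moff.
    + exact: pr_off.
    + by rewrite natrX -exprMn; apply: lerXn2r; rewrite ?nnegrE; lra.
  by lra.
exists Z; split => //; apply: subset_trans HZ => w /= Hw Hr; apply: Hw.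
have [r0 Hr0] := Hr; exists r0 => r r0r.
have : ~ no_run r w by move=> nw; apply: (Hr0 r r0r); left.
move=> nw; apply: contrapT => Ht; apply: nw.
apply: (in_bigsetI_nat (fun t => ~` run (t * (A * r)) r) _ _ _).2 => t.
rewrite add0n => /= tr Rt; apply: Ht; exists t => //; split => // offt.
apply: (Hr0 r r0r); right.
by apply: (in_bigsetU (fun t => off (t * (A * r)) r) _ _).2; exists t.
Qed.

(** Along the run the partial sum moves by at most [kap * s (b l.+1)] over the
    l-th block. As [s] at least doubles from one cut to the next, these bounds
    sum to at most [2 * kap * s (b l)], and the block that contains [m] adds at
    most [2 * C * kap * s m]. *)
Lemma run_bound w i r : run i r w -> ~ off i r w ->
  forall m, (b (i + r)%N < m)%N -> (m < b (i + A * r)%N)%N ->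
  `|psum X m w| <= (1 + 2 * kap + 2 * C * kap) * s m.
Proof.
move=> Rw noff.
have kap0 : 0 < kap by rewrite /kap; have := A_ge1; lra.
have exc j : (i <= j < i + A * r)%N -> forall m, (b j <= m <= b j.+1)%N ->
    `|psum X m w - psum X (b j) w| <= kap * s (b j.+1).
  move=> ij m bm; rewrite leNgt; apply/negP => hm.
  apply: ((in_bigsetI_nat quiet _ _ _).1 Rw j ij).
  apply: (in_bigsetU_nat (fun n => large_incr X (b j) n _) _ _ _).2.
  by exists m => //; rewrite /large_incr/= ltW.
have grow l : (i + l <= i + A * r)%N ->
    `|psum X (b (i + l)%N) w| <= s (b (i + r)%N) + 2 * kap * s (b (i + l)%N).
  elim: l => [|l IH] il.
    rewrite addn0; move/negP: noff; rewrite -ltNge /incr /psum big_ord0 subr0.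
    move/ltW => h; apply: (le_trans h); rewrite lerDl.
    by rewrite !mulr_ge0// ltW.
  rewrite addnS in il *.
  have := exc (i + l)%N; rewrite leq_addr il => /(_ isT (b (i + l).+1)).
  rewrite leqnn ltnW// => /(_ isT) h.
  have {}IH := IH (ltnW il).
  have /andP[s2 _] := s_b (i + l).
  have := ler_normD (psum X (b (i + l)%N) w)
    (psum X (b (i + l).+1) w - psum X (b (i + l)%N) w).
  rewrite addrC subrK => h2.
  have : kap * (2 * s (b (i + l)%N)) <= kap * s (b (i + l).+1).
    by rewrite ler_pM2l// ltW.
  lra.
move=> m bm mb.
have ex : exists k, (m <= b k)%N by exists (i + A * r)%N; exact: ltnW.
case: (ex_minnP ex) => k mk k_min.
have kA : (k <= i + A * r)%N by apply: k_min; exact: ltnW.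
have ik : (i + r < k)%N.
  by rewrite ltnNge; apply/negP => /b_nd /(leq_trans mk); rewrite leqNgt bm.
case: k ik mk k_min kA => // j; rewrite ltnS => ij mj j_min jA.
have bj : (b j < m)%N by rewrite ltnNge; apply/negP => /j_min; rewrite ltnn.
have ij' : (i <= j)%N by apply: leq_trans ij; exact: leq_addr.
have h1 := exc j; rewrite ij' jA in h1.
have {}h1 := h1 isT m; rewrite mj (ltnW bj) in h1; have {}h1 := h1 isT.
have := grow (j - i)%N; rewrite subnKC// => /(_ (ltnW jA)) h2.
have := ler_normD (psum X (b j) w) (psum X m w - psum X (b j) w).
rewrite addrC subrK => h3.
have /andP[_ s2] := s_b j.
have s3 : s (b j) <= s m by apply: s_nd; exact: ltnW.
have s4 : s (b (i + r)%N) <= s m by apply: s_nd; exact: ltnW.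
have C0 : 0 <= C.
  have := s_b_gt0 j.+1; have := s_b_gt0 j => u v.
  by rewrite -(@pmulr_lge0 _ (2 * s (b j))) ?mulr_gt0//; lra.
have h4 : kap * s (b j.+1) <= 2 * C * kap * s m.
  apply: (@le_trans _ _ (kap * (2 * C * s (b j)))); first by rewrite ler_pM2l.
  rewrite (_ : kap * (2 * C * s (b j)) = 2 * C * kap * s (b j)); last by ring.
  by apply: ler_wpM2l => //; rewrite !mulr_ge0// ltW.
have h5 : 2 * kap * s (b j) <= 2 * kap * s m.
  by apply: ler_wpM2l => //; rewrite mulr_ge0// ltW.
lra.
Qed.

End BoundedWindows.

(** The window of [small_window] lies strictly inside the run, past its first
    [r] blocks; it recurs for arbitrarily large [r], hence [N]. *)
Lemma window_max_bounded (M : R) : 0 < M ->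
  {ae P, forall w, (liminf_max X sigma (fun N => powR (ln N%:R) M) w < +oo)%E}.
Proof.
move=> M0.
have [A [r1 [A0 window]]] := small_window S0 S4 SD M0.
have := eventually_good_run A0.
case=> Z [mZ PZ HZ].
exists Z; split => //; apply: subset_trans HZ => w /= Hw [r0 Hr]; apply: Hw.
apply: (@limn_einf_ltpinfty _ _
  (1 + 2 * (32 * A%:R) + 2 * C * (32 * A%:R))) => n.
pose r := maxn n (maxn r0 r1).
have nr : (n <= r)%N by exact: leq_maxl.
have r0r : (r0 <= r)%N by rewrite /r !leq_max leqnn !orbT.
have r1r : (r1 <= r)%N by rewrite /r !leq_max leqnn !orbT.
have [t tr [Rw noff]] := Hr r r0r.
have [|N [rN SN NS]] := window r (t * (A * r))%N r1r.
  by rewrite leq_mul2r ltnW// orbT.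
exists N; first exact: leq_trans rN.
apply: ub_ereal_sup => _ [m /andP[Nm mN] <-].
have bm : (b (t * (A * r) + r)%N < m)%N.
  rewrite ltnNge; apply/negP => /s_nd h.
  have := lt_trans SN Nm; rewrite ltNge => /negP; apply.
  by apply: lerXn2r; rewrite ?nnegrE.
have mb : (m < b (t * (A * r) + A * r)%N)%N.
  rewrite ltnNge; apply/negP => /s_nd h.
  have := le_lt_trans mN NS; rewrite ltNge => /negP; apply.
  by apply: lerXn2r; rewrite ?nnegrE.
rewrite lee_fin ler_pdivrMr; first exact: run_bound Rw noff _ bm mb.
by apply: lt_le_trans (s_b_gt0 _) (s_nd (ltnW bm)).
Qed.

End Regimes.

Theorem theorem1 (d : measure_display) (T : measurableType d) (R : realType)
    (P : probability T R) (X : nat -> {RV P >-> R}) (sigma : nat -> R)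
    (indX : mutually_independent X)
    (meanX : forall j, ('E_P[X j] = 0)%E)
    (varX : forall j, ('E_P[fun w => (X j w ^+ 2)%R] = (sigma j ^+ 2)%:E)%E)
    (cond_a : sdev sigma n @[n --> \oo] --> +oo)
    (cond_b : exists C : R, forall j : nat,
      0 < sdev sigma j -> sdev sigma j.+1 / sdev sigma j <= C) :
  (forall M : R, 0 < M ->
    {ae P, forall w,
      (liminf_max X sigma (fun N => powR (ln N%:R) M) w < +oo)%E})
  /\
  ((forall lambda : R, 0 < lambda ->
      exists2 c : R, 0 < c &
        \forall n \near \oo, forall m : nat,
          2 * sdev sigma n ^+ 2 < sdev sigma m ^+ 2 ->
          (c%:E <= P [set w | (lambda * sdev sigma m
                               <= `|psum X m w - psum X n w|)%R])%E) ->
   forall xi : nat -> R,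
     (forall N N' : nat, (0 < N)%N -> (N <= N')%N -> xi N <= xi N') ->
     xi N @[N --> \oo] --> +oo ->
     {ae P, forall w,
       (liminf_max X sigma (fun N => powR (ln N%:R) (xi N)) w = +oo)%E}).
Proof.
have [C HC] := cond_b.
have blocks n0 := @geometric_blocks R (sdev sigma) C n0
  (fun n => sqrtr_ge0 _) (fun m n => @sdev_le R sigma m n) cond_a HC.
split.
  move=> M M0; have [b [_ s_b0 b_lt s_b]] := blocks 0%N.
  exact: (window_max_bounded indX meanX varX s_b0 b_lt s_b).
move=> cond_c xi _ xi_y.
(* An increment of size [lambda * s] leaves a partial sum of size
   [lambda / 2 * s], hence the factor 2 below. *)
have large (K : nat) : {ae P, forall w, exists N0, forall N, (N0 <= N)%N ->
    (K%:R%:E <= window_max X sigma (fun N => powR (ln N%:R) (xi N)) w N)%E}.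
  have lam0 : 0 < 2 * K.+1%:R :> R by rewrite mulr_gt0.
  have [c c0 [n0 _ Hc]] := cond_c _ lam0.
  have [b [n0b s_b0 b_lt s_b]] := blocks n0.
  have b_ge j : (n0 <= b j)%N.
    by elim: j => // j IH; exact: leq_trans IH (ltnW (b_lt j)).
  have s_ge1 j : 1 <= sdev sigma (b j).
    elim: j => // j IH; have /andP[h _] := s_b j.
    apply: le_trans (ltW h); lra.
  have G_ge j : c <= pr P (large_incr X (b j) (b j.+1)
      (2 * K.+1%:R * sdev sigma (b j.+1))).
    rewrite -lee_fin -prE; last exact: measurable_large_incr.
    apply: Hc => //; first exact: b_ge.
    by have /andP[+ _] := s_b j; have := s_ge1 j; rewrite !expr2; nra.
  have [Z [mZ PZ HZ]] :=
    window_max_ge_half indX s_b0 b_lt s_b lam0 c0 G_ge xi_y.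
  exists Z; split => //; apply: subset_trans HZ => w /= Hw [N0 HN0]; apply: Hw.
  exists N0 => N /HN0; apply: le_trans; rewrite lee_fin.
  by rewrite -(natr1 K); lra.
have [Z [mZ PZ HZ]] := ae_foralln large.
exists Z; split => //; apply: subset_trans HZ => w /= Hw H; apply: Hw.
exact: limn_einf_pinfty.
Qed.
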